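(* Let $(X,\mathcal{A},p)$ be a standard Borel probability space. The assignments $e\mapsto\mathcal{I}_e$ and $\mathcal{B}\mapsto e_\mathcal{B}$ are mutually inverse order-preserving bijections between the partially ordered set of ($p$-a.s. classes of) measure-preserving $p$-a.s. idempotent Markov kernels on $(X,\mathcal{A},p)$ and the set of $p$-complete sub-$\sigma$-algebras of $\mathcal{A}$ ordered by inclusion.
   Context: Kernels are identified up to $p$-a.s. equality, with composition $(\ell\circ k)(C\mid x)=\int\ell(C\mid y)k(dy\mid x)$; $e$ is $p$-a.s. idempotent if $e\circ e=e$ a.s.; idempotents are ordered by $e_1\le e_2$ iff $e_1\circ e_2=e_2\circ e_1=e_1$ a.s. $\mathcal{I}_e=\{B\in\mathcal{A}: e(B\mid x)=1_B(x)$ for $p$-a.a. $x\}$. $e_\mathcal{B}(A\mid x)=\mathbb{P}[A\mid\mathcal{B}](x)$ (regular conditional probability). A sub-$\sigma$-algebra $\mathcal{B}\subseteq\mathcal{A}$ is $p$-complete if it contains every $A\in\mathcal{A}$ with $p(A)=0$. *)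

(* Defs.v *)
From HB Require Import structures.
From mathcomp Require Import all_boot all_order all_algebra.
From mathcomp Require Import all_classical all_reals all_analysis measurable_realfun.
Set Implicit Arguments. Unset Strict Implicit. Unset Printing Implicit Defensive.
Import Order.TTheory GRing.Theory Num.Theory.
Local Open Scope classical_set_scope.
Local Open Scope ring_scope.
Local Open Scope ereal_scope.

Section Defs.
Context {d : measure_display} {X : measurableType d} {R : realType}.

(* (X, A) is standard Borel: Borel-isomorphic to a Borel subset of R
   (Kuratowski: equivalent to being Borel-isomorphic to a Polish space). *)
Definition standard_borel : Prop :=
  exists f : X -> R,
    [/\ injective f, measurable_fun setT f, measurable (range f)
      & forall A : set X, measurable A -> measurable (f @` A)].

Definition kcomp_ (l k : R.-pker X ~> X) : X -> set X -> \bar R :=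
  fun x C => \int[k x]_y l y C.

Definition kae (p : probability X R) (k l : X -> set X -> \bar R) : Prop :=
  {ae p, forall x, forall C, measurable C -> k x C = l x C}.

Definition kmeas_pres (p : probability X R) (k : R.-pker X ~> X) : Prop :=
  forall C, measurable C -> \int[p]_x k x C = p C.

Definition kidem (p : probability X R) (e : R.-pker X ~> X) : Prop :=
  kae p (kcomp_ e e) (fun x C => e x C).

Definition mp_idem (p : probability X R) (e : R.-pker X ~> X) : Prop :=
  kmeas_pres p e /\ kidem p e.

Definition kle (p : probability X R) (e1 e2 : R.-pker X ~> X) : Prop :=
  kae p (kcomp_ e1 e2) (fun x C => e1 x C) /\
  kae p (kcomp_ e2 e1) (fun x C => e1 x C).

Definition inv_sets (p : probability X R) (e : R.-pker X ~> X) : set (set X) :=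
  [set B | measurable B /\
           {ae p, forall x, e x B = (\1_B x)%:E}].

Definition p_complete_subsigma (p : probability X R) (G : set (set X)) : Prop :=
  [/\ sigma_algebra setT G, G `<=` measurable
    & forall A, measurable A -> p A = 0 -> G A].

Definition is_rcp (p : probability X R) (G : set (set X)) (e : R.-pker X ~> X) : Prop :=
  forall A : set X, measurable A ->
    (forall Y : set (\bar R), measurable Y -> G ((fun x => e x A) @^-1` Y)) /\
    (forall B, G B -> \int[p]_(x in B) e x A = p (A `&` B)).

End Defs.

(* Main.v *)
(** A measure-preserving kernel [e] averages functions, [kmean e phi x = \int[e
x] phi], and preserves [p]-integrals. If [kmean e g = g] a.s., then [kmean e
(max g c) >= max g c] a.s. with equal integrals, hence equality holds a.s.,
which makes the sublevel sets of [g] invariant. By idempotence this applies to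
[g = kmean e phi], so [kmean e phi] is the conditional expectation of [phi]
given the invariant sets; in particular [e] is a regular conditional probability
given its invariant sets. Conversely, a function measurable with respect to the
invariant sets is [e x]-a.s. constant equal to its value at [x], for a.a. [x];
hence conditional probabilities given [G] are idempotent, and inclusion of
invariant sets amounts to the order of kernels.

Regular conditional probabilities come from the disintegration of a probability
[P] on a product [T * Y]. Embed [Y] in the extended reals, let [H q] be a
Radon-Nikodym version of the conditional probability of the ray [y < q] for
rational [q], and take the law of [Q(t, u) = inf {q | u <= H q t}] for uniform
[u]. This is a probability kernel for every choice of versions, so that no null
set has to be removed, and for [r < q] its value at the ray [y < q] lies a.s.
between [H r] and [H q], which determines it by left continuity. *)

Require Import Defs.
From HB Require Import structures.
From mathcomp Require Import all_boot all_order all_algebra.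
From mathcomp Require Import all_classical all_reals all_analysis measurable_realfun.
Set Implicit Arguments. Unset Strict Implicit. Unset Printing Implicit Defensive.
Import Order.TTheory GRing.Theory Num.Theory.
Local Open Scope classical_set_scope.
Local Open Scope ring_scope.
Local Open Scope ereal_scope.

(** * Comparison of functions by their integrals *)

Lemma ae_forall_countable (d : measure_display) (T : measurableType d)
    (R : realType) (mu : {measure set T -> \bar R}) (I : countType)
    (P : I -> T -> Prop) :
  (forall i, {ae mu, forall x, P i x}) -> {ae mu, forall x i, P i x}.
Proof.
move=> aeP; pose Q n x := if unpickle n is Some i then P i x else True.
have aeQ n : {ae mu, forall x, Q n x}.
  by rewrite /Q; case: unpickle => [i|]; [exact: aeP|exact: aeW].
apply: filterS (ae_foralln aeQ) => x Qx i.
by have := Qx (pickle i); rewrite /Q pickleK.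
Qed.

Lemma measurable_preimage (d d' : measure_display) (T : measurableType d)
    (U : measurableType d') (f : T -> U) (Y : set U) :
  measurable_fun setT f -> measurable Y -> measurable (f @^-1` Y).
Proof. by move=> mf mY; rewrite -[f @^-1` Y]setTI; exact: mf. Qed.

Lemma measurableT_lee (d : measure_display) (T : measurableType d)
    (R : realType) (f g : T -> \bar R) :
  measurable_fun setT f -> measurable_fun setT g ->
  measurable [set x | f x <= g x].
Proof.
by move=> mf mg; rewrite -[X in measurable X]setTI; exact: measurable_lee.
Qed.

Lemma finite_measure_lty (d : measure_display) (T : measurableType d)
    (R : realType) (mu : {finite_measure set T -> \bar R}) (A : set T) :
  measurable A -> mu A < +oo.
Proof. by move=> mA; rewrite -ge0_fin_numE ?fin_num_measure. Qed.

Section integral_comparison.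
Context (d : measure_display) (T : measurableType d) (R : realType).
Variable mu : {measure set T -> \bar R}.
Implicit Types (D : set T) (f g : T -> \bar R).

Lemma ge0_integral_setID D E f : measurable D -> measurable E -> E `<=` D ->
  measurable_fun D f -> (forall x, D x -> 0 <= f x) ->
  \int[mu]_(x in D) f x =
  \int[mu]_(x in E) f x + \int[mu]_(x in D `\` E) f x.
Proof.
move=> mD mE ED mf f0; have mDE : measurable (D `\` E) by exact: measurableD.
have DE : E `|` (D `\` E) = D by rewrite setDUK.
rewrite -{1}DE ge0_integral_setU// ?DE//; exact/disj_set2P/setDIK.
Qed.

Lemma ge0_integral_ae_eq D f g : measurable D ->
  measurable_fun D f -> measurable_fun D g ->
  (forall x, D x -> 0 <= f x) -> (forall x, D x -> 0 <= g x) ->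
  {ae mu, forall x, D x -> f x <= g x} -> \int[mu]_(x in D) f x < +oo ->
  \int[mu]_(x in D) g x <= \int[mu]_(x in D) f x -> ae_eq mu D f g.
Proof.
move=> mD mf mg f0 g0 fg f_lty gf; apply: integral_ae_eq => //.
  apply/integrableP; split => //.
  by rewrite (eq_integral f)// => x; rewrite inE => Dx; rewrite gee0_abs ?f0.
move=> E ED mE.
have le_integral_on A : measurable A -> A `<=` D ->
    \int[mu]_(x in A) f x <= \int[mu]_(x in A) g x.
  move=> mA AD; apply: ae_ge0_le_integral => //.
  - by move=> x /AD; exact: f0.
  - exact: measurable_funS mf.
  - by move=> x /AD; exact: g0.
  - exact: measurable_funS mg.
  - by apply: filterS fg => x fgx /AD.
have DED : D `\` E `<=` D by exact: subDsetl.
have mDE : measurable (D `\` E) by exact: measurableD.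
have fDE_fin : \int[mu]_(x in D `\` E) f x \is a fin_num.
  rewrite ge0_fin_numE; last by apply: integral_ge0 => x /DED; exact: f0.
  by apply: le_lt_trans f_lty; exact: ge0_subset_integral.
apply/eqP; rewrite eq_le le_integral_on//= -(leeD2rE _ _ fDE_fin).
rewrite -ge0_integral_setID//; apply: le_trans gf.
by rewrite [leRHS](ge0_integral_setID mD mE)// leeD2l// le_integral_on.
Qed.

Lemma ge0_integral_ae_le f g :
  measurable_fun setT f -> measurable_fun setT g ->
  (forall x, 0 <= f x) -> (forall x, 0 <= g x) -> \int[mu]_x g x < +oo ->
  (forall E, measurable E -> \int[mu]_(x in E) f x <= \int[mu]_(x in E) g x) ->
  {ae mu, forall x, f x <= g x}.
Proof.
move=> mf mg f0 g0 g_lty fg.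
have mB : measurable [set x | g x <= f x] by exact: measurableT_lee.
have : ae_eq mu [set x | g x <= f x] g f.
  apply: ge0_integral_ae_eq => //.
  - exact: measurable_funTS.
  - exact: measurable_funTS.
  - exact: aeW.
  - by apply: le_lt_trans g_lty; exact: ge0_subset_integral.
  - exact: fg.
apply: filterS => x gfx; rewrite leNgt; apply/negP => gf.
by move: (gf); rewrite gfx ?ltxx//; exact: ltW.
Qed.

Lemma integral_mrestr D (mD : measurable D) f : measurable_fun setT f ->
  (forall x, 0 <= f x) ->
  \int[mrestr mu mD]_x f x = \int[mu]_(x in D) f x.
Proof.
move=> mf f0.
have nullDC : mrestr mu mD (~` D) = 0 by rewrite /mrestr setICl measure0.
rewrite (ge0_negligible_integral _ _ _ _ nullDC)//; last exact: measurableC.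
rewrite setTD setCK; apply: eq_measure_integral => A _ AD.
by rewrite /= /mrestr setIidl.
Qed.

End integral_comparison.

Section radon_nikodym.
Context (d : measure_display) (T : measurableType d) (R : realType).
Variables mu nu : {finite_measure set T -> \bar R}.

Lemma radon_nikodym_le1 :
  (forall E, measurable E -> nu E <= mu E) ->
  exists h : T -> \bar R, [/\ measurable_fun setT h, forall x, 0 <= h x <= 1 &
    forall E, measurable E -> \int[mu]_(x in E) h x = nu E].
Proof.
move=> numu.
have dom : nu `<< mu.
  apply/null_content_dominatesP => E mE muE0; apply/eqP.
  by rewrite -measure_le0 -muE0 numu.
have [h [h0 ih nuE]] := radon_nikodym_finite dom.
have mh : measurable_fun setT h by exact: measurable_int ih.
have h_le1 : {ae mu, forall x, h x <= cst 1 x}.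
  apply: ge0_integral_ae_le => //.
    by rewrite integral_cst// mul1e finite_measure_lty.
  by move=> E mE; rewrite -nuE// integral_cst// mul1e numu.
exists (fun x => mine (h x) 1); split; first exact: measurable_mine.
  by move=> x; rewrite le_min h0 lee01 ge_min lexx orbT.
move=> E mE; rewrite nuE//; apply: ae_eq_integral => //.
- by apply: measurable_funTS; exact: measurable_mine.
- exact: measurable_funTS.
- by apply: filterS h_le1 => x hx _; apply/min_idPl.
Qed.

End radon_nikodym.

(** * Probability kernels *)

Section constant_kernel.
Context (d d' : measure_display) (X : measurableType d) (Y : measurableType d')
  (R : realType).

Definition kcst (m : {measure set Y -> \bar R}) (x : X) :
  {measure set Y -> \bar R} := m.

HB.instance Definition _ (m : {measure set Y -> \bar R}) :=
  isKernel.Build _ _ _ _ _ (kcst m) (fun U _ => measurable_cst (m U)).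

HB.instance Definition _ (P : probability Y R) :=
  Kernel_isProbability.Build _ _ _ _ _ (kcst P) (fun=> probability_setT P).

End constant_kernel.

Section kernel_pullback.
Context (d d' d'' : measure_display) (X : measurableType d)
  (Y : measurableType d') (Z : measurableType d'') (R : realType).
Variables (k : R.-pker Y ~> Z) (f : X -> Y).

Definition kpullback (mf : measurable_fun setT f) (x : X) :
  {measure set Z -> \bar R} := k (f x).

Variable mf : measurable_fun setT f.

Let measurable_kpullback U : measurable U ->
  measurable_fun setT (kpullback mf ^~ U).
Proof. by move=> mU; exact: measurableT_comp (measurable_kernel k U mU) mf. Qed.

HB.instance Definition _ :=
  isKernel.Build _ _ _ _ _ (kpullback mf) measurable_kpullback.

HB.instance Definition _ := Kernel_isProbability.Build _ _ _ _ _ (kpullback mf)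
  (fun x => prob_kernel (f x)).

End kernel_pullback.

Section probability_kernel_composition.
Context (d d' d'' : measure_display) (X : measurableType d)
  (Y : measurableType d') (Z : measurableType d'') (R : realType).
Variables (l : R.-pker X ~> Y) (k : R.-pker (X * Y)%type ~> Z).

Let mkcomp_setT x : mkcomp l k x setT = 1.
Proof.
transitivity (\int[l x]_y cst 1 y).
  by apply: eq_integral => y _; exact: prob_kernel.
by rewrite integral_cst// prob_kernel mule1.
Qed.

HB.instance Definition _ :=
  Kernel_isProbability.Build _ _ _ _ _ (mkcomp l k) mkcomp_setT.

End probability_kernel_composition.

Section probability_kernel_lemmas.
Context (d d' : measure_display) (X : measurableType d) (Y : measurableType d')
  (R : realType).
Variable k : R.-pker X ~> Y.
Implicit Types (x : X) (B : set Y) (phi : Y -> \bar R).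

Lemma pker_le1 x B : measurable B -> k x B <= 1.
Proof.
by move=> mB; rewrite -(prob_kernel (s := k) x) le_measure ?inE.
Qed.

Lemma pker_setC x B : measurable B -> k x (~` B) = 1 - k x B.
Proof.
move=> mB; rewrite -setTD measureD//= ?setTI; last by rewrite prob_kernel ltry.
by rewrite prob_kernel.
Qed.

Lemma pker_aeP x B : measurable B ->
  {ae k x, forall y, B y} <-> k x B = 1.
Proof.
move=> mB; have mBC : measurable (~` B) by exact: measurableC.
split=> [aeB|kxB]; last first.
  by exists (~` B); split; rewrite // pker_setC// kxB subee.
by rewrite -[B]setCK pker_setC// (negligibleP _ mBC).1 ?sube0.
Qed.

Lemma integral_pker_lty (mu : {finite_measure set X -> \bar R}) B :
  measurable B -> \int[mu]_x k x B < +oo.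
Proof.
move=> mB; apply: (@le_lt_trans _ _ (\int[mu]_x cst 1 x)).
  apply: ge0_le_integral => //; first exact: measurable_kernel.
  by move=> x _; exact: pker_le1.
by rewrite integral_cst// mul1e finite_measure_lty.
Qed.

Definition kmean phi x := \int[k x]_y phi y.

Lemma kmean_ge0 phi x : (forall y, 0 <= phi y) -> 0 <= kmean phi x.
Proof. by move=> phi0; exact: integral_ge0. Qed.

Lemma measurable_kmean phi : (forall y, 0 <= phi y) ->
  measurable_fun setT phi -> measurable_fun setT (kmean phi).
Proof.
move=> phi0 mphi; apply: measurable_fun_integral_kernel => // U mU.
exact: measurable_kernel.
Qed.

Lemma kmean_cst c x : kmean (cst c) x = c.
Proof. by rewrite /kmean integral_cst// prob_kernel mule1. Qed.

Lemma kmean_indic B x : measurable B -> kmean (EFin \o \1_B) x = k x B.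
Proof. by move=> mB; rewrite /kmean integral_indic// setIT. Qed.

Lemma le_kmean phi psi x : (forall y, 0 <= phi y) ->
  measurable_fun setT phi -> measurable_fun setT psi ->
  (forall y, phi y <= psi y) -> kmean phi x <= kmean psi x.
Proof.
by move=> phi0 mphi mpsi phi_psi; apply: ge0_le_integral => // y _.
Qed.

Lemma pker_sublevel_eq1 phi (c : R) x :
  (0 <= c)%R -> measurable_fun setT phi -> (forall y, c%:E <= phi y) ->
  kmean phi x = c%:E -> k x [set y | phi y <= c%:E] = 1.
Proof.
move=> c0 mphi c_le kphi; apply/pker_aeP; first exact: measurableT_lee.
have : ae_eq (k x) setT (cst c%:E) phi.
  apply: ge0_integral_ae_eq => //.
  - by move=> y _; exact: le_trans (c_le y).
  - by apply: aeW => y _; exact: c_le.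
  - by rewrite [ltLHS]kmean_cst ltry.
  - by rewrite [leLHS]kphi [leRHS]kmean_cst.
by apply: filterS => y /(_ I) /= cphi; rewrite /= -cphi.
Qed.

End probability_kernel_lemmas.

Section kernel_composition_mean.
Context (d d' d'' : measure_display) (X : measurableType d)
  (Y : measurableType d') (Z : measurableType d'') (R : realType).
Variables (l : R.-pker Y ~> Z) (k : R.-pker X ~> Y).

Definition pkcomp : R.-pker X ~> Z := mkcomp k (kpullback l measurable_snd).

Lemma pkcompE x C : pkcomp x C = kmean k (l ^~ C) x.
Proof. by []. Qed.

Lemma kmean_pkcomp phi x : (forall z, 0 <= phi z) ->
  measurable_fun setT phi -> kmean pkcomp phi x = kmean k (kmean l phi) x.
Proof. by move=> phi0 mphi; exact: integral_kcomp. Qed.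

End kernel_composition_mean.

Lemma pkcomp_kdirac (d d' d'' : measure_display) (X : measurableType d)
    (Y : measurableType d') (Z : measurableType d'') (R : realType)
    (k : R.-pker X ~> Y) (g : Y -> Z) (mg : measurable_fun setT g) x C :
  measurable C -> pkcomp (kdirac mg) k x C = k x (g @^-1` C).
Proof.
move=> mC; rewrite pkcompE -(kmean_indic k)//; exact: measurable_preimage.
Qed.

(** * Measures on standard Borel spaces *)

Lemma lt_ereal_rat (R : realType) (x y : \bar R) : x < y ->
  exists q : rat, x < (ratr q)%:E < y.
Proof.
have rat_between (a b : R) : (a < b)%R ->
    exists q : rat, a%:E < (ratr q)%:E < b%:E.
  by move=> /rat_in_itvoo[q]; rewrite in_itv; exists q; rewrite !lte_fin.
move: x y => [x| |] [y| |]//; first exact: rat_between.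
- have /rat_between[q /andP[xq _]] : (x < x + 1)%R by rewrite ltrDl.
  by exists q; rewrite xq ltry.
- have /rat_between[q /andP[_ qy]] : (y - 1 < y)%R by rewrite ltrBlDr ltrDl.
  by exists q; rewrite qy ltNyr.
- by exists 0%R; rewrite ltNyr ltry.
Qed.

Lemma eq_ereal_rat (R : realType) (x y : \bar R) :
  (forall q : rat, (x < (ratr q)%:E) = (y < (ratr q)%:E)) -> x = y.
Proof.
move=> xyq; have ge_of_rats (a b : \bar R) :
    (forall q : rat, (a < (ratr q)%:E) = (b < (ratr q)%:E)) -> b <= a.
  move=> abq; rewrite leNgt; apply/negP => /lt_ereal_rat[q /andP[aq qb]].
  by move: aq; rewrite abq ltNge (ltW qb).
by apply/eqP; rewrite eq_le !ge_of_rats// => q; rewrite xyq.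
Qed.

Section rational_rays.
Context (R : realType).
Implicit Types (m : {measure set (\bar R) -> \bar R}) (q r : rat).

Definition rat_ray q : set (\bar R) := [set x | x < (ratr q)%:E].

Definition rat_rays : set (set (\bar R)) :=
  [set A | A = setT \/ exists q, A = rat_ray q].

Lemma measurable_rat_ray q : measurable (rat_ray q).
Proof.
by rewrite -[rat_ray q]setTI; exact: emeasurable_fun_infty_o.
Qed.

Lemma subset_rat_ray r q : (r <= q)%R -> rat_ray r `<=` rat_ray q.
Proof.
by move=> rq x /lt_le_trans; apply; rewrite lee_fin ler_rat.
Qed.

Lemma measurable_rat_rays : @measurable _ (\bar R) = <<s rat_rays >>.
Proof.
apply/seteqP; split; last first.
  apply: smallest_sub; first exact: sigma_algebra_measurable.
  by move=> _ [->//|[q ->]]; exact: measurable_rat_ray.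
rewrite [X in X `<=` _](_ : _ = emeasurable (@ocitv R))//.
rewrite ErealGenInftyO.measurableE.
apply: smallest_sub => [|_ [r ->]]; first exact: smallest_sigma_algebra.
rewrite [X in smallest _ _ X](_ : _ = \bigcup_(q : rat)
    (if (ratr q < r)%R then rat_ray q else set0)).
  apply: (@bigcupT_measurable_rat _ (g_sigma_algebraType rat_rays)) => q.
  by case: ifPn => // _; apply: sub_sigma_algebra; right; exists q.
apply/seteqP; split => x /=; rewrite in_itv/=.
  move=> /lt_ereal_rat[q /andP[xq]]; rewrite lte_fin => qr.
  by exists q; rewrite ?qr.
by move=> [q _]; case: ifPn => // qr /lt_trans; apply; rewrite lte_fin.
Qed.

Lemma setI_closed_rat_rays : setI_closed rat_rays.
Proof.
move=> _ _ [->|[q ->]] [->|[r ->]]; rewrite ?setIT ?setTI; first by left.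
- by right; exists r.
- by right; exists q.
right; have [qr|rq] := leP q r.
- by exists q; rewrite setIidl//; exact: subset_rat_ray.
- by exists r; rewrite setIidr//; apply: subset_rat_ray; exact: ltW.
Qed.

Lemma measure_unique_rat_rays m1 m2 :
  m1 setT < +oo -> m1 setT = m2 setT ->
  (forall q, m1 (rat_ray q) = m2 (rat_ray q)) ->
  forall A, measurable A -> m1 A = m2 A.
Proof.
move=> m1_lty m12T m12 A mA.
apply: (measure_unique rat_rays (fun=> setT)) => //.
- exact: measurable_rat_rays.
- exact: setI_closed_rat_rays.
- by move=> n; left.
- by rewrite bigcup_const.
- by move=> _ [->//|[q ->]].
Qed.

Lemma rat_ray_bigcup q :
  rat_ray q = \bigcup_n rat_ray (q - n.+1%:R^-1)%R.
Proof.
apply/seteqP; split => x; last first.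
  by move=> [n _]; apply: subset_rat_ray; rewrite lerBlDr lerDl.
rewrite /rat_ray/= => /lt_ereal_rat[r /andP[xr]].
rewrite lte_fin => rq; have [n rnq] := ltr_add_invr rq.
exists n => //=; rewrite (lt_trans xr)// lte_fin.
by rewrite rmorphB/= fmorphV/= ratr_nat ltrBrDr.
Qed.

Lemma measure_rat_ray_le m q c :
  (forall r, (r < q)%R -> m (rat_ray r) <= c) -> m (rat_ray q) <= c.
Proof.
move=> mc; rewrite rat_ray_bigcup; set F := fun n => rat_ray _.
have mF n : measurable (F n) by exact: measurable_rat_ray.
have ndF : nondecreasing_seq F.
  move=> i j ij; apply/subsetPset; apply: subset_rat_ray.
  by rewrite lerB// lef_pV2 ?posrE ?ltr0n// ler_nat.
have mUF : measurable (\bigcup_n F n) by exact: bigcupT_measurable.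
have mFcvg := nondecreasing_cvg_mu (mu := m) mF mUF ndF.
rewrite -(cvg_lim _ mFcvg)//; apply: lime_le; first exact: cvgP mFcvg.
by apply: nearW => n; apply: mc; rewrite ltrBlDr ltrDl invr_gt0.
Qed.

Lemma measure_unique_interleaved_rat_rays m1 m2 :
  m1 setT < +oo -> m1 setT = m2 setT ->
  (forall q, m1 (rat_ray q) <= m2 (rat_ray q)) ->
  (forall r q, (r < q)%R -> m2 (rat_ray r) <= m1 (rat_ray q)) ->
  forall A, measurable A -> m1 A = m2 A.
Proof.
move=> m1_lty m12T m1_le m2_le; apply: measure_unique_rat_rays => // q.
by apply/eqP; rewrite eq_le m1_le; apply: measure_rat_ray_le => r; exact: m2_le.
Qed.

End rational_rays.

Lemma measurable_left_inverse (d d' : measure_display) (T : measurableType d)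
    (U : measurableType d') (f : T -> U) : injective f ->
  (forall A, measurable A -> measurable (f @` A)) ->
  exists2 g : U -> T, measurable_fun setT g & cancel f g.
Proof.
move=> f_inj mf; pose g z := if z \in range f then pinv setT f z else point.
have fK : cancel f g.
  move=> x; rewrite /g mem_set; last by exists x.
  by rewrite pinvKV ?inE// => y z _ _; exact: f_inj.
exists g => // _ A mA; rewrite setTI.
have -> : g @^-1` A = f @` A `|` (~` range f `&` [set _ | A point]).
  apply/seteqP; split => z /=.
    have [[x _ <-]|zNf] := pselect (range f z).
      by rewrite fK; left; exists x.
    by rewrite /g memNset//; right.
  move=> [[x Ax <-]|[zNf Apt]]; first by rewrite fK.
  by rewrite /g memNset.
apply: measurableU; first exact: mf.
apply: measurableI; first by apply: measurableC; exact: mf.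
have [Apt|NApt] := pselect (A point).
- by rewrite (_ : mkset _ = setT) //; apply/seteqP; split.
- by rewrite (_ : mkset _ = set0) //; apply/seteqP; split.
Qed.

Section standard_borel_embedding.
Context (d : measure_display) (X : measurableType d) (R : realType).
Hypothesis hX : @standard_borel d X R.

Lemma standard_borel_retract : exists (F : X -> \bar R) (g : \bar R -> X),
  [/\ measurable_fun setT F, measurable_fun setT g & cancel F g].
Proof.
have [f [f_inj mf _ mimf]] := hX.
have EFinf_inj : injective (EFin \o f) by move=> x y [] /f_inj.
have [A mA|g mg fK] := measurable_left_inverse EFinf_inj.
  by rewrite -image_comp; apply: measurable_image_EFin; exact: mimf.
by exists (EFin \o f), g; split => //; exact/measurable_EFinP.
Qed.

Lemma pker_ae_eq (d' : measure_display) (T : measurableType d')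
    (mu : {measure set T -> \bar R}) (k l : R.-pker T ~> X) :
  (forall C, measurable C -> {ae mu, forall x, k x C = l x C}) ->
  {ae mu, forall x C, measurable C -> k x C = l x C}.
Proof.
move=> kl; have [F [g [mF mg FK]]] := standard_borel_retract.
have gFK C : F @^-1` (g @^-1` C) = C.
  by rewrite -comp_preimage; apply/seteqP; split=> x; rewrite /= FK.
have : {ae mu, forall x q,
    k x (F @^-1` rat_ray q) = l x (F @^-1` rat_ray q)}.
  apply: ae_forall_countable => q; apply: kl.
  by apply: measurable_preimage => //; exact: measurable_rat_ray.
apply: filterS => x klx C mC; rewrite -(gFK C).
have mgC : measurable (g @^-1` C) by exact: measurable_preimage.
rewrite -(pkcomp_kdirac k mF)// -(pkcomp_kdirac l mF)//.
apply: measure_unique_rat_rays => //.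
- by rewrite prob_kernel ltry.
- by rewrite !prob_kernel.
- by move=> q; rewrite !pkcomp_kdirac//; exact: measurable_rat_ray.
Qed.

End standard_borel_embedding.

(** * Disintegration *)

Lemma uniform_prob_itvNyc (R : realType) (a b x : R) (ab : (a < b)%R) :
  (a <= x <= b)%R ->
  uniform_prob ab `]-oo, x] = ((x - a) / (b - a))%:E.
Proof.
move=> /andP[ax xb]; rewrite /uniform_prob integral_uniform_pdf.
rewrite (_ : _ `&` _ = `[a, x]%classic); last first.
  apply/seteqP; split => y /=; rewrite !in_itv/=.
    by move=> [-> /andP[->]].
  by move=> /andP[-> yx]; rewrite yx (le_trans yx).
rewrite (eq_integral (cst (b - a)^-1%:E)); last first.
  move=> y; rewrite inE/= in_itv/= => /andP[ay yx].
  by rewrite /uniform_pdf ay (le_trans yx).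
rewrite integral_cst//= lebesgue_measure_itv/= lte_fin.
have [_|xa] := ltP a x; first by rewrite -EFinM mulrC.
have -> : x = a by apply: le_anti; rewrite xa.
by rewrite mule0 subrr mul0r.
Qed.

Section quantile_kernel.
Context (d : measure_display) (T : measurableType d) (R : realType).
Variable H : rat -> T -> \bar R.

Definition quantile (z : T * measurableTypeR R) : \bar R :=
  ereal_inf [set (ratr q)%:E | q in [set q | z.2%:E <= H q z.1]].

Lemma quantile_lt z q :
  rat_ray q (quantile z) <-> exists2 r, (r < q)%R & z.2%:E <= H r z.1.
Proof.
split => [/ereal_inf_lt[_ [r zr <-]]|[r rq zr]].
  by rewrite lte_fin ltr_rat; exists r.
by apply/ereal_inf_ltP; exists (ratr r)%:E; [exists r|rewrite lte_fin ltr_rat].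
Qed.

Hypothesis mH : forall q, measurable_fun setT (H q).

Lemma measurable_quantile : measurable_fun setT quantile.
Proof.
apply: (measurability _ (measurable_rat_rays R)) => // _ [_ [->|[q ->]] <-].
  by rewrite preimage_setT setIT.
rewrite setTI [X in measurable X](_ : _ = \bigcup_(r : rat) (if (r < q)%R
    then [set z : T * measurableTypeR R | z.2%:E <= H r z.1] else set0)).
  apply: bigcupT_measurable_rat => r; case: ifPn => // _.
  apply: measurableT_lee; first exact/measurable_EFinP.
  exact: measurableT_comp.
apply/seteqP; split => z.
  by move=> /quantile_lt[r rq zr]; exists r => //; rewrite rq.
by move=> [r _]; case: ifPn => // rq zr; apply/quantile_lt; exists r.
Qed.

Definition quantile_kernel : R.-pker T ~> \bar R :=
  mkcomp (kcst (uniform_prob (@ltr01 R))) (kdirac measurable_quantile).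

Let measurable_quantile_section t (A : set (\bar R)) : measurable A ->
  measurable [set u : measurableTypeR R | A (quantile (t, u))].
Proof.
apply: measurable_preimage; apply: measurableT_comp => //.
exact: measurable_quantile.
Qed.

Lemma quantile_kernelE t A : measurable A ->
  quantile_kernel t A = uniform_prob (@ltr01 R) [set u | A (quantile (t, u))].
Proof.
move=> mA; rewrite -[in RHS](setIT [set u | _]) -integral_indic//.
exact: measurable_quantile_section.
Qed.

Let uniform01_le (h : \bar R) : 0 <= h <= 1 ->
  uniform_prob (@ltr01 R) [set u | u%:E <= h] = h.
Proof.
case: h => [h| |] /andP[]; rewrite ?leye_eq ?leeNy_eq// !lee_fin => h0 h1.
rewrite (_ : mkset _ = `]-oo, h]%classic); last first.
  by apply/seteqP; split => u /=; rewrite in_itv/= lee_fin.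
by rewrite uniform_prob_itvNyc ?h0// !subr0 divr1.
Qed.

Let measurable_lee_cst (h : \bar R) :
  measurable [set u : measurableTypeR R | u%:E <= h].
Proof. by apply: measurableT_lee => //; exact/measurable_EFinP. Qed.

Lemma quantile_kernel_ray_le t q : 0 <= H q t <= 1 ->
  (forall r, (r < q)%R -> H r t <= H q t) ->
  quantile_kernel t (rat_ray q) <= H q t.
Proof.
move=> Hq01 Hle; have mq := measurable_rat_ray R q.
rewrite quantile_kernelE// -[leRHS]uniform01_le//.
apply: le_measure; rewrite ?inE.
- exact: measurable_quantile_section.
- exact: measurable_lee_cst.
- move=> u /quantile_lt[r rq /= ur]; apply: le_trans ur _.
  exact: Hle.
Qed.

Lemma quantile_kernel_ray_ge t r q : 0 <= H r t <= 1 -> (r < q)%R ->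
  H r t <= quantile_kernel t (rat_ray q).
Proof.
move=> Hr01 rq; have mq := measurable_rat_ray R q.
rewrite quantile_kernelE// -[leLHS]uniform01_le//.
apply: le_measure; rewrite ?inE.
- exact: measurable_lee_cst.
- exact: measurable_quantile_section.
- by move=> u ur; apply/quantile_lt; exists r.
Qed.

End quantile_kernel.

HB.instance Definition _ (d d' : measure_display) (T : measurableType d)
    (U : measurableType d') :=
  isMeasurableFun.Build _ _ _ _ (@fst T U) measurable_fst.

HB.instance Definition _ (d d' : measure_display) (T : measurableType d)
    (U : measurableType d') :=
  isMeasurableFun.Build _ _ _ _ (@snd T U) measurable_snd.

Section finite_measure_image.
Context (d d' : measure_display) (T : measurableType d) (U : measurableType d')
  (R : realType).
Variables (m : {finite_measure set T -> \bar R}) (f : {mfun T >-> U}).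

(* The library equips [pushforward m f] with a measure structure only through
   a proof of measurability of [f], which instance resolution cannot find. *)
Definition mfimage : set U -> \bar R := pushforward m f.

Let mfimage0 : mfimage set0 = 0. Proof. exact: measure0. Qed.

Let mfimage_ge0 A : 0 <= mfimage A. Proof. exact: measure_ge0. Qed.

Let mfimage_sigma_additive : semi_sigma_additive mfimage.
Proof. exact: measure_semi_sigma_additive. Qed.

HB.instance Definition _ :=
  isMeasure.Build _ _ _ mfimage mfimage0 mfimage_ge0 mfimage_sigma_additive.

Let mfimage_fin : fin_num_fun mfimage.
Proof.
by move=> A mA; rewrite fin_num_measure//; exact: measurable_preimage.
Qed.

HB.instance Definition _ := Measure_isFinite.Build _ _ _ mfimage mfimage_fin.

End finite_measure_image.

Section conditional_probability.
Context (d d' : measure_display) (T : measurableType d) (Y : measurableType d')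
  (R : realType).
Variable P : probability (T * Y)%type R.
Implicit Types (A : set Y) (B : set T) (h : T -> \bar R).

Definition conditional_probability A h :=
  [/\ measurable_fun setT h, forall t, 0 <= h t <= 1 &
    forall B, measurable B ->
      \int[distribution P fst]_(t in B) h t = P (B `*` A)].

Lemma conditional_probability_exists A : measurable A ->
  exists h, conditional_probability A h.
Proof.
move=> mA; have mTA : measurable ([set: T] `*` A) by exact: measurableX.
pose nu := mfimage (mfrestr mTA (finite_measure_lty P mTA)) fst.
have nuE B : nu B = P (B `*` A).
  by congr (P _); rewrite -setXT -setXI setIT setTI.
have [B mB|h [mh h01 hE]] := @radon_nikodym_le1 _ _ _ (distribution P fst) nu.
  rewrite [leLHS]nuE; apply: (le_measure P); rewrite ?inE.
  - exact: measurableX.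
  - exact: measurable_preimage.
  - by move=> z [].
by exists h; split => // B mB; rewrite hE// -nuE.
Qed.

Lemma conditional_probability_ae_le A A' h h' :
  measurable A -> measurable A' -> A `<=` A' ->
  conditional_probability A h -> conditional_probability A' h' ->
  {ae distribution P fst, forall t, h t <= h' t}.
Proof.
move=> mA mA' AA' [mh h01 hE] [mh' h01' hE'].
apply: ge0_integral_ae_le => //.
- by move=> t; case/andP: (h01 t).
- by move=> t; case/andP: (h01' t).
- by rewrite hE'// finite_measure_lty//; exact: measurableX.
- move=> B mB; rewrite hE// hE'//; apply: le_measure; rewrite ?inE.
  + exact: measurableX.
  + exact: measurableX.
  + by move=> z [Bz Az]; split => //; exact: AA'.
Qed.

End conditional_probability.

Definition disintegration (d d' : measure_display) (T : measurableType d)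
    (Y : measurableType d') (R : realType) (P : probability (T * Y)%type R)
    (K : R.-pker T ~> Y) :=
  forall A B, measurable A -> measurable B ->
    \int[distribution P fst]_(t in B) K t A = P (B `*` A).

Section disintegration_existence.
Context (d : measure_display) (T : measurableType d) (R : realType).

Lemma disintegration_of_interleaved_rat_rays
    (P : probability (T * \bar R)%type R) (K : R.-pker T ~> \bar R) :
  (forall B q, measurable B ->
    \int[distribution P fst]_(t in B) K t (rat_ray q) <= P (B `*` rat_ray q)) ->
  (forall B r q, measurable B -> (r < q)%R ->
    P (B `*` rat_ray r) <= \int[distribution P fst]_(t in B) K t (rat_ray q)) ->
  disintegration P K.
Proof.
move=> K_le K_ge A B mA mB.
have mBY : measurable (B `*` [set: \bar R]) by exact: measurableX.
pose law1 : {measure set _ -> \bar R} :=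
  mkcomp (kcst (mrestr (distribution P fst) mB))
    (kpullback K measurable_snd) tt.
pose law2 : {measure set _ -> \bar R} :=
  mfimage (mfrestr mBY (finite_measure_lty P mBY)) snd.
have law1E C : measurable C ->
    law1 C = \int[distribution P fst]_(t in B) K t C.
  by move=> mC; rewrite -(integral_mrestr _ mB)//; exact: measurable_kernel.
have law2E C : law2 C = P (B `*` C).
  by congr (P _); rewrite -setTX -setXI setTI setIT.
have law1T : law1 setT = P (B `*` [set: \bar R]).
  rewrite law1E// (eq_integral (cst 1)); last by move=> t _; exact: prob_kernel.
  by rewrite integral_cst// mul1e setXT.
rewrite -law1E// -law2E; apply: measure_unique_interleaved_rat_rays => //.
- by rewrite law1T finite_measure_lty.
- by rewrite law1T law2E.
- by move=> q; rewrite law1E ?law2E ?K_le//; exact: measurable_rat_ray.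
- by move=> r q rq; rewrite law1E ?law2E ?K_ge//; exact: measurable_rat_ray.
Qed.

Lemma disintegration_ereal (P : probability (T * \bar R)%type R) :
  exists K : R.-pker T ~> \bar R, disintegration P K.
Proof.
have mray q : measurable (rat_ray q) := measurable_rat_ray R q.
have [H HP] := choice (fun q => conditional_probability_exists P (mray q)).
have mH q : measurable_fun setT (H q) by case: (HP q).
have H01 q t : 0 <= H q t <= 1 by case: (HP q).
have H0 q t : 0 <= H q t by case/andP: (H01 q t).
have HE q B : measurable B ->
    \int[distribution P fst]_(t in B) H q t = P (B `*` rat_ray q).
  by case: (HP q) => _ _; exact.
have H_ndecr : {ae distribution P fst, forall t,
    forall rq : rat * rat, (rq.1 < rq.2)%R -> H rq.1 t <= H rq.2 t}.
  apply: ae_forall_countable => -[r q] /=.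
  have [rq|_] := boolP (r < q)%R; last exact: aeW.
  have rayS : @rat_ray R r `<=` rat_ray q by exact/subset_rat_ray/ltW.
  have := conditional_probability_ae_le (mray r) (mray q) rayS (HP r) (HP q).
  by apply: filterS => t + _.
pose K := quantile_kernel mH.
have mK q : measurable_fun setT (K ^~ (rat_ray q)).
  exact: measurable_kernel.
exists K; apply: disintegration_of_interleaved_rat_rays => B.
- move=> q mB; rewrite -HE//; apply: ae_ge0_le_integral => //.
  + exact: measurable_funTS.
  + exact: measurable_funTS.
  + apply: filterS H_ndecr => t Ht _; apply: quantile_kernel_ray_le => // r rq.
    exact: (Ht (r, q)).
- move=> r q mB rq; rewrite -HE//; apply: ge0_le_integral => //.
  + exact: measurable_funTS.
  + exact: measurable_funTS.
  + by move=> t _; exact: quantile_kernel_ray_ge.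
Qed.

Lemma disintegration_exists (d' : measure_display) (Y : measurableType d')
    (P : probability (T * Y)%type R) : @standard_borel _ Y R ->
  exists K : R.-pker T ~> Y, disintegration P K.
Proof.
move=> hY; have [F [g [mF mg FK]]] := standard_borel_retract hY.
have mG : measurable_fun setT (fun z : T * Y => (z.1, F z.2)).
  by apply: measurable_fun_pair => //; exact: measurableT_comp.
pose G : {mfun (T * Y)%type >-> (T * \bar R)%type} :=
  HB.pack (fun z : T * Y => (z.1, F z.2)) (isMeasurableFun.Build _ _ _ _ _ mG).
have [K KE] := disintegration_ereal (distribution P G).
exists (pkcomp (kdirac mg) K) => A B mA mB.
under eq_integral do rewrite pkcomp_kdirac//.
rewrite [LHS]KE//; last exact: measurable_preimage.
by congr (P _); apply/seteqP; split=> -[t y] /=; rewrite /preimage /= FK.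
Qed.

End disintegration_existence.

(** * Sub-sigma-algebras and invariant sets *)

Definition measurable_wrt (X : Type) (d' : measure_display)
    (Y : measurableType d') (G : set (set X)) (f : X -> Y) :=
  forall B, measurable B -> G (f @^-1` B).

Lemma measurable_fun_wrt (d d' : measure_display) (X : measurableType d)
    (Y : measurableType d') (G : set (set X)) (f : X -> Y) :
  G `<=` measurable -> measurable_wrt G f -> measurable_fun setT f.
Proof. by move=> Gm Gf _ B mB; rewrite setTI; apply: Gm; exact: Gf. Qed.

Section sub_sigma_algebra.
Context (d : measure_display) (X : measurableType d) (R : realType).
Variables (p : probability X R) (G : set (set X)).
Hypotheses (sG : sigma_algebra setT G) (Gm : G `<=` measurable).

Lemma measurable_subsigmaE : @measurable _ (g_sigma_algebraType G) = G.
Proof. by rewrite /measurable/= sigma_algebra_id. Qed.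

Lemma measurable_wrtP (d' : measure_display) (Y : measurableType d')
    (f : X -> Y) :
  measurable_wrt G f <-> @measurable_fun _ _ (g_sigma_algebraType G) Y setT f.
Proof.
split=> [Gf _ B mB|mf B mB].
  by rewrite setTI measurable_subsigmaE; exact: Gf.
by rewrite -measurable_subsigmaE; exact: measurable_preimage.
Qed.

Lemma measurable_to_subsigma :
  measurable_fun setT (id : X -> g_sigma_algebraType G).
Proof. by move=> _ A; rewrite measurable_subsigmaE setTI; exact: Gm. Qed.

Lemma subsigma_integral_ae_eq (f g : X -> \bar R) :
  (forall x, 0 <= f x) -> (forall x, 0 <= g x) ->
  measurable_wrt G f -> measurable_wrt G g -> \int[p]_x f x < +oo ->
  (forall B, G B -> \int[p]_(x in B) f x = \int[p]_(x in B) g x) ->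
  {ae p, forall x, f x = g x}.
Proof.
move=> f0 g0 Gf Gg f_lty fg; pose T := g_sigma_algebraType G.
have mfT : measurable_fun setT (f : T -> \bar R) by exact/measurable_wrtP.
have mgT : measurable_fun setT (g : T -> \bar R) by exact/measurable_wrtP.
pose proj : {mfun X >-> T} := HB.pack (id : X -> T)
  (isMeasurableFun.Build _ _ _ _ _ measurable_to_subsigma).
have integral_proj (h : T -> \bar R) B : measurable_fun setT h ->
    (forall x, 0 <= h x) -> @measurable _ T B ->
    \int[distribution p proj]_(x in B) h x = \int[p]_(x in B) h x.
  move=> mh h0 mB.
  apply: (ge0_integral_pushforward measurable_to_subsigma) => //.
  exact: measurable_funTS.
have : ae_eq (distribution p proj) setT f g.
  apply: integral_ae_eq => //.
    apply/integrableP; split => //.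
    under eq_integral do rewrite gee0_abs//.
    by rewrite integral_proj.
  move=> B _ mB; rewrite !integral_proj//; apply: fg.
  by rewrite -measurable_subsigmaE.
move=> [N [mN pN fgN]]; exists N; split => //.
- by apply: Gm; rewrite -measurable_subsigmaE.
- by move=> x fgx; apply: fgN => /(_ I).
Qed.

End sub_sigma_algebra.

Lemma p_complete_subsigma_ae_eq (d : measure_display) (X : measurableType d)
    (R : realType) (p : probability X R) (G : set (set X)) (A B : set X) :
  p_complete_subsigma p G -> G A -> measurable B ->
  {ae p, forall x, A x <-> B x} -> G B.
Proof.
move=> [sG Gm Gp] GA mB AB; have mA := Gm _ GA.
have G_null N : measurable N -> (forall x, N x -> ~ (A x <-> B x)) -> G N.
  move=> mN NAB; apply: Gp => //; apply/negligibleP => //.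
  by apply: negligibleS AB => x /= Nx; exact: NAB.
have GE := measurable_subsigmaE sG.
have GAB : G (A `\` B).
  by apply: G_null; [exact: measurableD|move=> x [Ax NBx] [/(_ Ax)]].
have GBA : G (B `\` A).
  by apply: G_null; [exact: measurableD|move=> x [Bx NAx] [_ /(_ Bx)]].
rewrite -(setUIDK B A) setIC -(setDD A B) -GE.
by apply: measurableU; [apply: measurableD|]; rewrite GE.
Qed.

Section measure_preserving_kernels.
Context (d : measure_display) (X : measurableType d) (R : realType).
Variables (p : probability X R) (e : R.-pker X ~> X).
Hypothesis mpe : kmeas_pres p e.
Implicit Types (phi g : X -> \bar R) (B : set X).

Lemma integral_kmean phi : (forall y, 0 <= phi y) -> measurable_fun setT phi ->
  \int[p]_x kmean e phi x = \int[p]_y phi y.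
Proof.
move=> phi0 mphi.
rewrite -[LHS](@kmean_pkcomp _ _ _ unit _ _ _ e (kcst p) _ tt)//.
by apply: eq_measure_integral => A mA _; exact: mpe.
Qed.

Lemma kmeas_pres_ae (P : X -> Prop) : {ae p, forall y, P y} ->
  {ae p, forall x, {ae e x, forall y, P y}}.
Proof.
move=> [N [mN pN PN]].
have meN : measurable_fun setT (fun x => e x N) by exact: measurable_kernel.
have /(ae_eq_integral_abs p measurableT meN) : \int[p]_x `|e x N| = 0.
  by under eq_integral do rewrite gee0_abs//; rewrite mpe.
by apply: filterS => x /(_ I) exN; exists N.
Qed.

Lemma inv_sets_subinvariant B : measurable B ->
  {ae p, forall x, B x -> e x B = 1} -> inv_sets p e B.
Proof.
move=> mB eB; split => //.
have : ae_eq p setT (EFin \o \1_B) (e ^~ B).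
  apply: ge0_integral_ae_eq => //.
  - exact/measurable_EFinP.
  - exact: measurable_kernel.
  - by move=> x _; rewrite /= lee_fin.
  - apply: filterS eB => x eBx _; rewrite /= indicE.
    have [/set_mem/eBx ->//|_] := boolP (x \in B); exact: measure_ge0.
  - by rewrite integral_indic// setIT finite_measure_lty.
  - by rewrite mpe// integral_indic// setIT.
by apply: filterS => x /(_ I).
Qed.

Lemma inv_sets_p_complete : p_complete_subsigma p (inv_sets p e).
Proof.
split; [split| |].
- by split => //; apply: aeW => x; rewrite measure0 indic0.
- move=> B [mB eB]; rewrite setTD; split; first exact: measurableC.
  apply: filterS eB => x eB; rewrite pker_setC// eB !indicE in_setC.
  by case: (x \in B); rewrite ?subee ?sube0.
- move=> F IF; have mF n : measurable (F n) by case: (IF n).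
  have mUF : measurable (\bigcup_n F n) by exact: bigcupT_measurable.
  apply: inv_sets_subinvariant => //.
  apply: filterS (ae_foralln (fun n => (IF n).2)) => x eF [n _ Fnx].
  apply/eqP; rewrite eq_le pker_le1//=.
  have <- : e x (F n) = 1 by rewrite eF indicE mem_set.
  by apply: le_measure; rewrite ?inE//; exact: bigcup_sup.
- by move=> B [].
- move=> A mA pA; apply: inv_sets_subinvariant => //.
  by exists A; split => // x /= /not_implyP[].
Qed.

Lemma kmean_maxe_fixed g (c : R) : (0 <= c)%R -> (forall x, 0 <= g x) ->
  measurable_fun setT g -> \int[p]_x g x < +oo ->
  {ae p, forall x, kmean e g x = g x} ->
  {ae p, forall x, kmean e (fun y => maxe (g y) c%:E) x = maxe (g x) c%:E}.
Proof.
move=> c0 g0 mg g_lty eg; set phi := fun y => maxe (g y) c%:E.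
have phi0 x : 0 <= phi x by rewrite le_max g0.
have mphi : measurable_fun setT phi by exact: measurable_maxe.
have phi_lty : \int[p]_x phi x < +oo.
  apply: (@le_lt_trans _ _ (\int[p]_x (g x + c%:E))).
    apply: ge0_le_integral => //.
    - exact: emeasurable_funD.
    - by move=> x _; rewrite ge_max leeDl//= leeDr.
  rewrite ge0_integralD// integral_cst//= [X in _ * X]probability_setT mule1.
  by rewrite lte_add_pinfty ?ltry.
have : ae_eq p setT phi (kmean e phi).
  apply: ge0_integral_ae_eq => //.
  - exact: measurable_kmean.
  - by move=> x _; exact: kmean_ge0.
  - apply: filterS eg => x egx _; rewrite ge_max -{1}egx -(kmean_cst e c%:E x).
    by rewrite !le_kmean// => y; rewrite le_max lexx ?orbT.
  - by rewrite integral_kmean.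
by apply: filterS => x /(_ I).
Qed.

Lemma inv_sets_sublevel g (c : R) : (forall x, 0 <= g x) ->
  measurable_fun setT g -> \int[p]_x g x < +oo ->
  {ae p, forall x, kmean e g x = g x} -> inv_sets p e [set x | g x <= c%:E].
Proof.
move=> g0 mg g_lty eg; have [c0|c0] := leP 0%R c; last first.
  rewrite (_ : mkset _ = set0); first by case: inv_sets_p_complete => -[].
  apply/seteqP; split => x //= gxc.
  by move: (le_trans (g0 x) gxc); rewrite lee_fin leNgt c0.
apply: inv_sets_subinvariant; first exact: measurableT_lee.
apply: filterS (kmean_maxe_fixed c0 g0 mg g_lty eg) => x + gxc.
rewrite (max_idPr gxc) => /pker_sublevel_eq1 <-//.
- by congr (e x _); apply/seteqP; split => y /=; rewrite ge_max lexx andbT.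
- exact: measurable_maxe.
- by move=> y; rewrite le_max lexx orbT.
Qed.

Lemma measurable_wrt_inv_sets_of_fixed g : (forall x, 0 <= g x) ->
  measurable_fun setT g -> \int[p]_x g x < +oo ->
  {ae p, forall x, kmean e g x = g x} -> measurable_wrt (inv_sets p e) g.
Proof.
move=> g0 mg g_lty eg; have [sI _ _] := inv_sets_p_complete.
apply/(measurable_wrtP sI).
apply: (measurability _ (ErealGenOInfty.measurableE R)) => //.
move=> _ [_ [c ->] <-]; rewrite setTI.
rewrite (_ : _ @^-1` _ = ~` [set x | g x <= c%:E]).
  by apply: measurableC; apply: sub_sigma_algebra; exact: inv_sets_sublevel.
by apply/seteqP; split => x /=; rewrite in_itv/= andbT ltNge => /negP.
Qed.

End measure_preserving_kernels.

Section invariant_sets.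
Context (d : measure_display) (X : measurableType d) (R : realType).
Variable p : probability X R.
Implicit Types (e : R.-pker X ~> X) (phi g : X -> \bar R) (B : set X).

Lemma eq_inv_sets e e' : kae p (fun x C => e x C) (fun x C => e' x C) ->
  inv_sets p e = inv_sets p e'.
Proof.
by move=> ee'; apply/seteqP; split => B [mB eB]; split => //;
  apply: filterS2 ee' eB => x /(_ B mB) ->.
Qed.

Lemma inv_sets_ae e B : inv_sets p e B ->
  {ae p, forall x, {ae e x, forall y, B y <-> B x}}.
Proof.
move=> [mB eB]; apply: filterS eB => x; rewrite indicE.
have [/set_mem Bx exB|/negP xNB exB] := boolP (x \in B).
- by apply: filterS ((pker_aeP e x mB).2 exB) => y By; split.
- have Bx : ~ B x by move=> /mem_set.
  by exists B; split => // y /= yB; apply: contrapT => By; apply: yB; split.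
Qed.

Lemma measurable_wrt_inv_sets_ae_cst e g : measurable_wrt (inv_sets p e) g ->
  {ae p, forall x, {ae e x, forall y, g y = g x}}.
Proof.
move=> Ig; have : {ae p, forall x (q : rat),
    {ae e x, forall y, rat_ray q (g y) <-> rat_ray q (g x)}}.
  apply: ae_forall_countable => q.
  have : inv_sets p e (g @^-1` rat_ray q) by exact/Ig/measurable_rat_ray.
  exact: inv_sets_ae.
apply: filterS => x gx; apply: filterS (ae_forall_countable gx) => y gyx.
by apply: eq_ereal_rat => q; apply/idP/idP => /gyx.
Qed.

Lemma kmean_fixed_of_measurable_wrt e g : (forall x, 0 <= g x) ->
  measurable_wrt (inv_sets p e) g -> {ae p, forall x, kmean e g x = g x}.
Proof.
move=> g0 Ig; have mg : measurable_fun setT g.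
  by apply: measurable_fun_wrt Ig => B [].
apply: filterS (measurable_wrt_inv_sets_ae_cst Ig) => x gx.
rewrite -[RHS](kmean_cst e (g x) x); apply: ge0_ae_eq_integral => //.
- by move=> y _; exact: g0.
- by apply: filterS gx => y.
Qed.

Lemma integral_kmean_inv_sets e phi B : kmeas_pres p e ->
  (forall x, 0 <= phi x) -> measurable_fun setT phi -> inv_sets p e B ->
  \int[p]_(x in B) kmean e phi x = \int[p]_(x in B) phi x.
Proof.
move=> mpe phi0 mphi IB; have [mB _] := IB.
have mphiB : measurable_fun setT (phi \_ B).
  by apply/(measurable_restrictT _ _).1 => //; exact: measurable_funTS.
have phiB0 x : 0 <= (phi \_ B) x by exact: erestrict_ge0.
rewrite integral_mkcond [RHS]integral_mkcond -(integral_kmean mpe phiB0 mphiB).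
apply: ge0_ae_eq_integral => //.
- apply/(measurable_restrictT _ _).1 => //; apply: measurable_funTS.
  exact: measurable_kmean.
- exact: measurable_kmean.
- by move=> x _; apply: erestrict_ge0 => y _; exact: kmean_ge0.
- by move=> x _; exact: kmean_ge0.
apply: filterS (inv_sets_ae IB) => x exB _; rewrite patchE.
have [/set_mem Bx|/negP xNB] := boolP (x \in B).
- apply: ge0_ae_eq_integral => //; apply: filterS exB => y yxB _.
  by rewrite patchE mem_set//; exact/yxB.
- rewrite -[LHS](kmean_cst e 0 x); apply: ge0_ae_eq_integral => //.
  apply: filterS exB => y yxB _; rewrite patchE memNset// => /yxB Bx.
  exact/xNB/mem_set.
Qed.

Lemma kidem_kmean e phi : kidem p e -> (forall x, 0 <= phi x) ->
  measurable_fun setT phi ->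
  {ae p, forall x, kmean e (kmean e phi) x = kmean e phi x}.
Proof.
move=> ide phi0 mphi; apply: filterS ide => x ex.
rewrite -kmean_pkcomp//; apply: eq_measure_integral => A mA _; exact: ex.
Qed.

Lemma measurable_wrt_kmean e phi : mp_idem p e -> (forall x, 0 <= phi x) ->
  measurable_fun setT phi -> \int[p]_x phi x < +oo ->
  measurable_wrt (inv_sets p e) (kmean e phi).
Proof.
move=> [mpe ide] phi0 mphi phi_lty.
apply: measurable_wrt_inv_sets_of_fixed => //.
- by move=> x; exact: kmean_ge0.
- exact: measurable_kmean.
- by rewrite integral_kmean.
- exact: kidem_kmean.
Qed.

End invariant_sets.

(** * Regular conditional probabilities and idempotent kernels *)

Section regular_conditional_probability.
Context (d : measure_display) (X : measurableType d) (R : realType).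
Variables (p : probability X R) (G : set (set X)).
Hypotheses (sG : sigma_algebra setT G) (Gm : G `<=` measurable).
Implicit Types e : R.-pker X ~> X.

Lemma rcp_exists : @standard_borel d X R -> exists e, is_rcp p G e.
Proof.
move=> hX; pose T := g_sigma_algebraType G.
have mgraph : measurable_fun [set: X] (fun x => ((x : T), x)).
  by apply: measurable_fun_pair => //; exact: measurable_to_subsigma.
pose graph : {mfun X >-> (T * X)%type} :=
  HB.pack (fun x : X => ((x : T), x)) (isMeasurableFun.Build _ _ _ _ _ mgraph).
have [K KE] := disintegration_exists (distribution p graph) hX.
exists (kpullback K (measurable_to_subsigma sG Gm)) => A mA; split.
  by apply/(measurable_wrtP sG); exact: measurable_kernel.
move=> B GB; have mB : @measurable _ T B by rewrite measurable_subsigmaE.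
have mKA : measurable_fun setT (K ^~ A) by exact: measurable_kernel.
transitivity (\int[distribution (distribution p graph) fst]_(t in B) K t A).
  apply/esym/(ge0_integral_pushforward (measurable_to_subsigma sG Gm)) => //.
  exact: measurable_funTS.
by rewrite KE// setIC.
Qed.

Lemma is_rcp_meas_pres e : is_rcp p G e -> kmeas_pres p e.
Proof.
move=> re A mA; have [_ ->] := re _ mA; first by rewrite setIT.
by rewrite -(measurable_subsigmaE sG).
Qed.

Lemma is_rcp_unique e e' : @standard_borel d X R ->
  is_rcp p G e -> is_rcp p G e' ->
  kae p (fun x C => e x C) (fun x C => e' x C).
Proof.
move=> hX re re'; apply: pker_ae_eq => // C mC.
have [Ge ie] := re _ mC; have [Ge' ie'] := re' _ mC.
apply: (subsigma_integral_ae_eq sG Gm) => //; first exact: integral_pker_lty.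
by move=> B GB; rewrite ie// ie'.
Qed.

Lemma sub_inv_sets_rcp e : is_rcp p G e -> G `<=` inv_sets p e.
Proof.
move=> re B GB; have mB := Gm GB; have meB := measurable_kernel e B mB.
apply: inv_sets_subinvariant => //; first exact: is_rcp_meas_pres.
have : ae_eq p B (e ^~ B) (cst 1).
  apply: ge0_integral_ae_eq => //.
  - exact: measurable_funTS.
  - by apply: aeW => x _; exact: pker_le1.
  - apply: le_lt_trans (integral_pker_lty e p mB).
    exact: ge0_subset_integral.
  - by have [_ ->//] := re _ mB; rewrite setIid integral_cst// mul1e.
by apply: filterS => x.
Qed.

Lemma is_rcp_mp_idem e : @standard_borel d X R -> is_rcp p G e -> mp_idem p e.
Proof.
move=> hX re; split; first exact: is_rcp_meas_pres.
apply: (pker_ae_eq hX (k := pkcomp e e)) => C mC.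
apply: (kmean_fixed_of_measurable_wrt (g := e ^~ C)) => //.
by move=> B mB; apply: sub_inv_sets_rcp => //; have [+ _] := re _ mC; exact.
Qed.

End regular_conditional_probability.

Section idempotent_kernels.
Context (d : measure_display) (X : measurableType d) (R : realType).
Variable p : probability X R.
Implicit Types e : R.-pker X ~> X.

Lemma inv_sets_rcp (G : set (set X)) e :
  p_complete_subsigma p G -> is_rcp p G e -> inv_sets p e = G.
Proof.
move=> Gc re; have [sG Gm _] := Gc; apply/seteqP; split; last first.
  exact: sub_inv_sets_rcp.
move=> B [mB eB]; have [+ _] := re _ mB => /(_ [set 1] (emeasurable_set1 _)) GB.
apply: (p_complete_subsigma_ae_eq Gc GB mB); apply: filterS eB => x /= ->.
rewrite indicE; have [/set_mem Bx|/negP xNB] := boolP (x \in B); first by split.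
by split=> [/eqP|Bx]; [rewrite eq_sym onee_eq0|case: (xNB (mem_set Bx))].
Qed.

Lemma is_rcp_pkcomp e (k : R.-pker X ~> X) : mp_idem p e ->
  (forall B C, inv_sets p e B -> measurable C ->
     \int[p]_(x in B) k x C = p (C `&` B)) ->
  is_rcp p (inv_sets p e) (pkcomp k e).
Proof.
move=> mie kp C mC; have [mpe _] := mie; have mk := measurable_kernel k C mC.
split.
  apply: (measurable_wrt_kmean (phi := k ^~ C)) => //.
  exact: integral_pker_lty.
move=> B IB; rewrite -(kp B C IB mC).
exact: (integral_kmean_inv_sets (phi := k ^~ C)).
Qed.

Lemma mp_idem_is_rcp e : mp_idem p e -> is_rcp p (inv_sets p e) e.
Proof.
move=> mie C mC; have [mpe _] := mie.
have <- : kmean e (EFin \o \1_C) = e ^~ C.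
  by apply/funext => x; exact: kmean_indic.
have mC1 : measurable_fun setT (EFin \o \1_C : X -> \bar R).
  exact/measurable_EFinP.
have C1_ge0 x : 0 <= (EFin \o \1_C : X -> \bar R) x by rewrite /= lee_fin.
split; first apply: measurable_wrt_kmean => //.
  by rewrite integral_indic// setIT finite_measure_lty.
move=> B IB; have [mB _] := IB.
by rewrite integral_kmean_inv_sets// integral_indic.
Qed.

Lemma inv_sets_kle e1 e2 : @standard_borel d X R -> mp_idem p e1 ->
  mp_idem p e2 -> inv_sets p e1 `<=` inv_sets p e2 -> kle p e1 e2.
Proof.
move=> hX mi1 mi2 I12; have [mp1 _] := mi1.
have [sI1 Im1 _] := inv_sets_p_complete mp1.
have rcp1 := mp_idem_is_rcp mi1; have rcp2 := mp_idem_is_rcp mi2; split.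
- apply: (pker_ae_eq hX (k := pkcomp e1 e2)) => C mC.
  apply: (kmean_fixed_of_measurable_wrt (g := e1 ^~ C)) => //.
  by move=> B mB; apply: I12; have [+ _] := rcp1 _ mC; exact.
- apply: (is_rcp_unique sI1 Im1 hX (e := pkcomp e2 e1)) => //.
  apply: is_rcp_pkcomp => // B C IB mC.
  by have [_ ->//] := rcp2 _ mC; exact: I12.
Qed.

Lemma kle_inv_sets e1 e2 : kmeas_pres p e2 -> kle p e1 e2 ->
  inv_sets p e1 `<=` inv_sets p e2.
Proof.
move=> mp2 [e12 _] B [mB eB]; split => //.
apply: filterS3 e12 (kmeas_pres_ae mp2 eB) eB => x e12x e2B <-.
rewrite -e12x// -(kmean_indic e2)//; apply: ge0_ae_eq_integral => //.
- exact/measurable_EFinP.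
- exact: measurable_kernel.
- by move=> y _; rewrite /= lee_fin.
- by apply: filterS e2B => y ->.
Qed.

Lemma kle_inv_setsP e1 e2 : @standard_borel d X R -> mp_idem p e1 ->
  mp_idem p e2 -> kle p e1 e2 <-> inv_sets p e1 `<=` inv_sets p e2.
Proof.
move=> hX mi1 mi2; split; last exact: inv_sets_kle.
by apply: kle_inv_sets; case: mi2.
Qed.

End idempotent_kernels.

Theorem theorem4p16 (d : measure_display) (X : measurableType d) (R : realType)
  (p : probability X R) (hX : @standard_borel d X R) :
  (* e |-> I_e is well defined on p-a.s. classes and lands in p-complete sub-sigma-algebras *)
  (forall e e' : R.-pker X ~> X, mp_idem p e -> mp_idem p e' ->
     kae p (fun x C => e x C) (fun x C => e' x C) -> inv_sets p e = inv_sets p e') /\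
  (forall e : R.-pker X ~> X, mp_idem p e -> p_complete_subsigma p (inv_sets p e)) /\
  (* B |-> e_B is defined (regular conditional probabilities exist),
     lands in measure-preserving a.s. idempotent kernels, and I_{e_B} = B *)
  (forall G, p_complete_subsigma p G ->
     (exists e : R.-pker X ~> X, is_rcp p G e) /\
     (forall e : R.-pker X ~> X, is_rcp p G e -> mp_idem p e /\ inv_sets p e = G)) /\
  (* e_{I_e} = e (p-a.s.) *)
  (forall e : R.-pker X ~> X, mp_idem p e ->
     forall e' : R.-pker X ~> X, is_rcp p (inv_sets p e) e' ->
       kae p (fun x C => e' x C) (fun x C => e x C)) /\
  (* order preservation, both directions *)
  (forall e1 e2 : R.-pker X ~> X, mp_idem p e1 -> mp_idem p e2 ->
     (kle p e1 e2 <-> inv_sets p e1 `<=` inv_sets p e2)) /\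
  (forall (G1 G2 : set (set X)) (e1 e2 : R.-pker X ~> X),
     p_complete_subsigma p G1 -> p_complete_subsigma p G2 ->
     is_rcp p G1 e1 -> is_rcp p G2 e2 ->
     (G1 `<=` G2 <-> kle p e1 e2)).
Proof.
split; first by move=> e e' _ _; exact: eq_inv_sets.
split; first by move=> e [mpe _]; exact: inv_sets_p_complete.
split.
  move=> G Gc; have [sG Gm _] := Gc; split; first exact: rcp_exists.
  by move=> e re; split; [exact: is_rcp_mp_idem re|exact: inv_sets_rcp].
split.
  move=> e mie e' re'; have [sI Im _] := inv_sets_p_complete mie.1.
  by apply: is_rcp_unique re' _ => //; exact: mp_idem_is_rcp.
split; first by move=> e1 e2; exact: kle_inv_setsP.
move=> G1 G2 e1 e2 G1c G2c re1 re2.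
have [[sG1 Gm1 _] [sG2 Gm2 _]] := (G1c, G2c).
have mi1 := is_rcp_mp_idem sG1 Gm1 hX re1.
have mi2 := is_rcp_mp_idem sG2 Gm2 hX re2.
rewrite (kle_inv_setsP hX mi1 mi2).
by rewrite (inv_sets_rcp G1c re1) (inv_sets_rcp G2c re2).
Qed.
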